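(* Let $n \ge 1$ be an integer and let $\pi = (\pi_1, \ldots, \pi_{2n+1})$ be a uniformly random permutation of $\{1, \ldots, 2n+1\}$. For $1 \le j \le 2n$ let $X_j = +1$ if $\pi_j < \pi_{j+1}$ and $X_j = -1$ if $\pi_j > \pi_{j+1}$. Let $S_0 = 0$ and $S_m = \sum_{j=1}^m X_j$ for $1 \le m \le 2n$, and let $$N_{2n} = \sum_{j=1}^{2n} 1(S_{j-1} \ge 0,\ S_j \ge 0).$$ Then $$\mathbb{P}(N_{2n} = 2k) = \frac{1}{2^{2n}} \binom{2k}{k} \binom{2n-2k}{n-k} \quad \text{for every } k = 0, 1, \ldots, n;$$ that is, $N_{2n}$ has the discrete arcsine law.
   Context: Here $\pi_j$ denotes the value of the permutation at position $j$ (one-line notation), and ''uniformly random'' means that each of the $(2n+1)!$ permutations of $\{1, \ldots, 2n+1\}$ has probability $1/(2n+1)!$. The notation $1(A)$ is the indicator of the event $A$, so $1(S_{j-1} \ge 0,\ S_j \ge 0)$ equals $1$ if both $S_{j-1} \ge 0$ and $S_j \ge 0$, and $0$ otherwise. Thus $N_{2n}$ is the number of edges $(S_{j-1}, S_j)$ of the walk lying above zero up to time $2n$. The phrase ''discrete arcsine law'' refers to exactly the displayed probability distribution on $\{0, 2, \ldots, 2n\}$. *)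

(* Defs.v *)
From mathcomp Require Import all_boot all_order all_fingroup all_algebra.
Set Implicit Arguments. Unset Strict Implicit. Unset Printing Implicit Defensive.
Import Order.TTheory GRing.Theory Num.Theory.
Local Open Scope ring_scope.

(* Permutations of {1, ..., m+1} are encoded as 'S_m.+1, which permutes
   'I_m.+1 = {0, ..., m}; [oneline] shifts positions and values back to
   {1, ..., m+1}. It is meaningful only for 1 <= j <= m.+1. *)
Definition oneline (m : nat) (s : 'S_m.+1) (j : nat) : nat :=
  (s (inord j.-1)).+1.

(* Meaningful for 1 <= j <= m, where the two compared values are distinct. *)
Definition stepX (m : nat) (s : 'S_m.+1) (j : nat) : int :=
  if (oneline s j < oneline s j.+1)%N then 1 else -1.

Definition walkS (m : nat) (s : 'S_m.+1) (i : nat) : int :=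
  \sum_(1 <= j < i.+1) stepX s j.

Definition numN (m : nat) (s : 'S_m.+1) : nat :=
  (\sum_(1 <= j < m.+1)
     ((0 <= walkS s j.-1)%R && (0 <= walkS s j)%R : bool))%N.

Definition unif_perm_prob (m : nat) (E : pred 'S_m) : rat :=
  \sum_(s : 'S_m | E s) (m`!%:R)^-1.

(* Main.v *)
Require Import Defs.
From mathcomp Require Import all_boot all_order all_fingroup all_algebra.
From mathcomp Require Import zify ring lra.
Set Implicit Arguments. Unset Strict Implicit. Unset Printing Implicit Defensive.
Import Order.TTheory GRing.Theory Num.Theory.
Local Open Scope ring_scope.

(** Replace the permutation by a word of 2n+1 independent uniform letters of
    Z/K; as K grows, repeated letters become negligible. The cyclic differences
    V_0 = U_0, V_j = U_j - U_(j-1) are again independent and uniform, and the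
    number of descents among the first m steps is the quotient of V_0 + ... + V_m
    by K. Hence S_(2i-1) > 0 iff the i-th partial sum of the steps
    K - V_(2l) - V_(2l+1) is positive, and since an edge lies above zero iff its
    endpoint at odd time does, N_(2n) is twice the number of positive partial
    sums of a walk with n i.i.d., asymptotically symmetric and tie-free steps.
    By Sparre Andersen's argument this number has the law of the position of the
    first maximum, whose law factors as P_r P_(n-r) up to O(1/K), where P_r is
    the probability that r partial sums are all positive. Summing over r
    determines the limit of P_r recursively as 'C(2r, r) / 4^r. *)

(** * Averages over words *)

Definition avg (T : finType) (f : T -> rat) : rat := (\sum_x f x) / #|T|%:R.

(** Averaging letter by letter makes conditioning on the first letter a matter of computation. *)
Fixpoint wavg (T : finType) (n : nat) (f : seq T -> rat) : rat :=
  if n is n'.+1 then avg (fun x => wavg n' (fun w => f (x :: w))) else f [::].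

Lemma eq_avg (T : finType) (f g : T -> rat) : f =1 g -> avg f = avg g.
Proof. by move=> fg; rewrite /avg; congr (_ / _); apply: eq_bigr. Qed.

Lemma avgD (T : finType) (f g : T -> rat) :
  avg (fun x => f x + g x) = avg f + avg g.
Proof. by rewrite /avg big_split mulrDl. Qed.

Lemma avgZ (T : finType) c (f : T -> rat) : avg (fun x => c * f x) = c * avg f.
Proof. by rewrite /avg -mulr_sumr mulrA. Qed.

Lemma avg_const (T : finType) c : (0 < #|T|)%N -> avg (fun _ : T => c) = c.
Proof.
move=> T0; rewrite /avg sumr_const -[c *+ _]mulr_natr mulfK //.
by rewrite pnatr_eq0 -lt0n.
Qed.

Lemma ler_avg (T : finType) (f g : T -> rat) :
  (forall x, f x <= g x) -> avg f <= avg g.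
Proof.
by move=> fg; rewrite /avg ler_wpM2r ?invr_ge0 ?ler0n //; apply: ler_sum.
Qed.

Lemma avg_exchange (T S : finType) (f : T -> S -> rat) :
  avg (fun x => avg (f x)) = avg (fun y => avg (f^~ y)).
Proof.
rewrite /avg -!mulr_suml exchange_big /= -!mulrA; congr (_ * _).
by rewrite mulrC.
Qed.

Lemma avg_reindex (T : finType) (h : T -> T) (f : T -> rat) :
  injective h -> avg (fun x => f (h x)) = avg f.
Proof. by move=> hI; rewrite /avg [in RHS](reindex_inj hI). Qed.

Lemma eq_wavg (T : finType) n (f g : seq T -> rat) :
  (forall w, size w = n -> f w = g w) -> wavg n f = wavg n g.
Proof.
elim: n f g => [|n IH] f g fg /=; first exact: fg.
by apply: eq_avg => x; apply: IH => w sw; apply: fg; rewrite /= sw.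
Qed.

Lemma wavgD (T : finType) n (f g : seq T -> rat) :
  wavg n (fun w => f w + g w) = wavg n f + wavg n g.
Proof.
by elim: n f g => [|n IH] f g //=; rewrite -avgD; apply: eq_avg => x; rewrite IH.
Qed.

Lemma wavgZ (T : finType) n c (f : seq T -> rat) :
  wavg n (fun w => c * f w) = c * wavg n f.
Proof.
by elim: n f => [|n IH] f //=; rewrite -avgZ; apply: eq_avg => x; rewrite IH.
Qed.

Lemma wavg_const (T : finType) n c :
  (0 < #|T|)%N -> wavg n (fun _ : seq T => c) = c.
Proof.
move=> T0; elim: n => [|n IH] //=.
by rewrite -[RHS](avg_const _ T0); apply: eq_avg.
Qed.

Lemma wavg_sum (T : finType) n m (f : 'I_m -> seq T -> rat) :
  (0 < #|T|)%N ->
  wavg n (fun w => \sum_i f i w) = \sum_i wavg n (f i).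
Proof.
move=> T0; elim: m f => [|m IH] f.
  by rewrite big_ord0 -[RHS](wavg_const n 0 T0); apply: eq_wavg => w _; rewrite big_ord0.
rewrite big_ord_recl -IH -wavgD; apply: eq_wavg => w _.
by rewrite big_ord_recl.
Qed.

Lemma ler_wavg (T : finType) n (f g : seq T -> rat) :
  (forall w, size w = n -> f w <= g w) -> wavg n f <= wavg n g.
Proof.
elim: n f g => [|n IH] f g fg /=; first exact: fg.
by apply: ler_avg => x; apply: IH => w sw; apply: fg; rewrite /= sw.
Qed.

Lemma avg_norm (T : finType) (f : T -> rat) : `|avg f| <= avg (fun x => `|f x|).
Proof.
rewrite /avg normrM [`|_^-1|]ger0_norm ?invr_ge0 ?ler0n //.
by rewrite ler_wpM2r ?invr_ge0 ?ler0n // ler_norm_sum.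
Qed.

Lemma wavg_avg (T S : finType) n (f : S -> seq T -> rat) :
  avg (fun x => wavg n (f x)) = wavg n (fun w => avg (f^~ w)).
Proof.
elim: n f => [|n IH] f //=; rewrite avg_exchange.
by apply: eq_avg => x; rewrite IH.
Qed.

Lemma wavgS (T : finType) n (f : seq T -> rat) :
  wavg n.+1 f = wavg n (fun w => avg (fun x => f (x :: w))).
Proof. exact: wavg_avg. Qed.

Lemma wavg_rcons (T : finType) n (f : seq T -> rat) :
  wavg n.+1 f = avg (fun x => wavg n (fun w => f (rcons w x))).
Proof.
elim: n f => [|n IH] f //.
transitivity (avg (fun x => avg (fun z => wavg n (fun w => f (x :: rcons w z))))).
  by apply: eq_avg => x; rewrite -(IH (fun w => f (x :: w))).
by rewrite avg_exchange.
Qed.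

Lemma wavg_cat (T : finType) m n (f : seq T -> rat) :
  wavg (m + n) f = wavg m (fun u => wavg n (fun v => f (u ++ v))).
Proof. by elim: m f => [|m IH] f //=; apply: eq_avg => x; rewrite IH. Qed.

Lemma wavg_rev (T : finType) n (f : seq T -> rat) :
  wavg n (fun w => f (rev w)) = wavg n f.
Proof.
elim: n f => [|n IH] f //; rewrite [RHS]wavg_rcons /=; apply: eq_avg => x.
by rewrite -(IH (fun w => f (rcons w x))); apply: eq_wavg => w _; rewrite rev_cons.
Qed.

Lemma wavg_map (T : finType) n (h : T -> T) (f : seq T -> rat) :
  injective h -> wavg n (fun w => f (map h w)) = wavg n f.
Proof.
move=> hI; elim: n f => [|n IH] f //=; rewrite -[RHS](avg_reindex _ hI).
by apply: eq_avg => x; rewrite -(IH (fun w => f (h x :: w))).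
Qed.

(** Addition here is modulo K+1. Given the earlier letters, a running sum is the next letter
    translated by a fixed amount, hence again uniform. *)
Lemma wavg_scanl (K n : nat) (p : 'I_K.+1) (f : seq 'I_K.+1 -> rat) :
  wavg n (fun w => f (scanl +%R p w)) = wavg n f.
Proof.
elim: n p f => [|n IH] p f //=.
rewrite -[RHS](avg_reindex _ (addrI p)); apply: eq_avg => x.
by rewrite -(IH (p + x) (fun w => f (p + x :: w))).
Qed.

Definition flat (T : Type) (w : seq (T * T)) : seq T :=
  flatten [seq [:: p.1; p.2] | p <- w].

Lemma avg_pair (T S : finType) (f : T * S -> rat) :
  avg f = avg (fun x => avg (fun y => f (x, y))).
Proof.
rewrite /avg -mulr_suml -mulrA card_prod natrM invfM [_^-1 * _]mulrC.
congr (_ * _); rewrite pair_bigA /=; apply: eq_bigr => -[x y] _ //.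
Qed.

Lemma wavg_flat (T : finType) n (f : seq T -> rat) :
  wavg (2 * n) f = wavg n (fun w => f (flat w)).
Proof.
elim: n f => [|n IH] f //; rewrite mulnS /= avg_pair.
by apply: eq_avg => x; apply: eq_avg => y; rewrite IH.
Qed.

Lemma wavg_tuple (T : finType) n (f : seq T -> rat) :
  wavg n f = avg (fun t : n.-tuple T => f t).
Proof.
elim: n f => [|n IH] f.
  rewrite /avg card_tuple expn0 divr1 (big_pred1 [tuple]) // => t.
  by apply/esym/eqP; exact: tuple0.
rewrite /= /avg card_tuple expnSr natrM invfM mulrA; congr (_ / _).
rewrite (reindex (fun p : T * n.-tuple T => cons_tuple p.1 p.2)) /=; last first.
  exists (fun t => (thead t, behead_tuple t)) => [[x t] _|t _].
    by rewrite /= theadE; congr (_, _); apply/val_inj.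
  by rewrite [RHS]tuple_eta.
rewrite -(pair_bigA _ (fun x (t : n.-tuple T) => f (x :: t))) /=.
by rewrite mulr_suml; apply: eq_bigr => x _; rewrite IH /avg card_tuple.
Qed.

(** * Positive partial sums and the position of the maximum *)

Definition wsum (T : Type) (y : T -> int) (w : seq T) : int := \sum_(x <- w) y x.

Definition npos (T : Type) (y : T -> int) (w : seq T) : nat :=
  \sum_(i < size w) (0 < wsum y (take i.+1 w))%R.

Fixpoint wmax (T : Type) (y : T -> int) (w : seq T) : int :=
  if w is x :: w' then Num.max 0 (y x + wmax y w') else 0.

(** With [wmax] the largest prefix sum (0 for the empty prefix), the strict inequality sends ties to
    the earliest position. *)
Fixpoint argmax (T : Type) (y : T -> int) (w : seq T) : nat :=
  if w is x :: w' then
    if 0 < y x + wmax y w' then (argmax y w').+1 else 0%N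
  else 0%N.

Fixpoint suffpos (T : Type) (y : T -> int) (w : seq T) : bool :=
  if w is x :: w' then (0 < wsum y w) && suffpos y w' else true.

Lemma wsum_cons (T : Type) (y : T -> int) x w : wsum y (x :: w) = y x + wsum y w.
Proof. by rewrite /wsum big_cons. Qed.

Lemma wsum_cat (T : Type) (y : T -> int) u v :
  wsum y (u ++ v) = wsum y u + wsum y v.
Proof. by rewrite /wsum big_cat. Qed.

Lemma wsum_rcons (T : Type) (y : T -> int) x w :
  wsum y (rcons w x) = wsum y w + y x.
Proof. by rewrite -cats1 wsum_cat /wsum big_seq1. Qed.

Lemma npos_rcons (T : Type) (y : T -> int) x w :
  npos y (rcons w x) = (npos y w + (0 < wsum y (rcons w x))%R)%N.
Proof.
rewrite /npos size_rcons big_ord_recr /= -[(size w).+1](size_rcons w x) take_size.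
congr (_ + _)%N; apply: eq_bigr => i _.
by rewrite -cats1 takel_cat.
Qed.

Lemma wmax_rcons (T : Type) (y : T -> int) x w :
  wmax y (rcons w x) = Num.max (wmax y w) (wsum y (rcons w x)).
Proof.
elim: w => [|z w IH] /=; first by rewrite /wsum big_seq1 addr0.
rewrite wsum_cons IH; lia.
Qed.

Lemma wsum_le_wmax (T : Type) (y : T -> int) w : wsum y w <= wmax y w.
Proof.
by elim: w => [|x w IH] /=; [rewrite /wsum big_nil | rewrite wsum_cons; lia].
Qed.

Lemma wmax_ge0 (T : Type) (y : T -> int) w : 0 <= wmax y w.
Proof. by case: w => [|x w] //=; lia. Qed.

Lemma argmax_cons (T : Type) (y : T -> int) x w :
  0 < wsum y (x :: w) -> argmax y (x :: w) = (argmax y w).+1.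
Proof.
rewrite wsum_cons /= => s0; have := wsum_le_wmax y w.
by case: ifP => //; lia.
Qed.

Lemma argmax_rcons (T : Type) (y : T -> int) x w :
  wsum y (rcons w x) <= wmax y w -> argmax y (rcons w x) = argmax y w.
Proof.
elim: w => [|z w IH] /=; first by rewrite /wsum big_seq1 addr0; case: ifP => //; lia.
rewrite wsum_cons wmax_rcons => h.
have [m0|m0] := ltrP 0 (y z + wmax y w).
  by rewrite IH; [case: ifP => //; lia | lia].
by case: ifP => //; lia.
Qed.

Lemma argmax_le (T : Type) (y : T -> int) w : (argmax y w <= size w)%N.
Proof. by elim: w => [|x w IH] //=; case: ifP. Qed.

Lemma wmax_cat (T : Type) (y : T -> int) u v :
  suffpos y u -> wmax y v = 0 -> wmax y (u ++ v) = wsum y u.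
Proof.
elim: u => [|x u IH] /=; first by rewrite /wsum big_nil.
by rewrite wsum_cons => /andP[s0 su] mv; rewrite IH //; lia.
Qed.

(** Earlier prefixes lie strictly below the end of [u] iff every nonempty suffix of [u] has positive
    sum; later ones lie no higher iff no prefix sum of [v] is positive. *)
Lemma argmax_cat (T : Type) (y : T -> int) u v :
  (argmax y (u ++ v) == size u) = suffpos y u && (wmax y v == 0).
Proof.
elim: u => [|x u IH] /=.
  by case: v => [|x v] //=; case: ifP; lia.
rewrite wsum_cons; case: ifP => m0; last first.
  apply/esym/negbTE/negP => /andP[/andP[s0 su] /eqP mv].
  by rewrite wmax_cat // s0 in m0.
rewrite eqSS IH; case su: (suffpos y u) => /=; last by rewrite andbF.
case mv: (wmax y v == 0); last by rewrite andbF.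
by rewrite -(wmax_cat su (eqP mv)) m0.
Qed.

(* The weight [F] fixes the multiset of steps; conditioning on the sign of the
   total, deleting the last step (total nonpositive) or, for the argmax, the
   first step (total positive) affects both statistics in the same way. *)
Lemma sparre_andersen (T : finType) (y : T -> int) n (F : seq T -> rat)
    (phi : nat -> rat) :
  (forall u v, perm_eq u v -> F u = F v) ->
  wavg n (fun w => F w * phi (npos y w)) =
  wavg n (fun w => F w * phi (argmax y w)).
Proof.
elim: n F phi => [|n IH] F phi Fp; first by rewrite /= /npos big_ord0.
pose pos w : rat := (0 < wsum y w)%R%:R; pose neg w : rat := (wsum y w <= 0)%R%:R.
have splitE w : 1 = pos w + neg w by rewrite /pos /neg leNgt; case: (0 < _).
have wsum_perm u v : perm_eq u v -> wsum y u = wsum y v.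
  by move=> uv; apply: perm_big.
have cut f : wavg n.+1 f = wavg n.+1 (fun w : seq T => pos w * f w) +
                           wavg n.+1 (fun w => neg w * f w).
  rewrite -wavgD; apply: eq_wavg => w _.
  by rewrite -mulrDl -splitE mul1r.
have Frc x u v : perm_eq u v -> F (rcons u x) = F (rcons v x).
  by move=> uv; apply: Fp; rewrite perm_rcons perm_sym perm_rcons perm_cons perm_sym.
have src x u v : perm_eq u v -> wsum y (rcons u x) = wsum y (rcons v x).
  by move=> uv; apply: wsum_perm; rewrite perm_rcons perm_sym perm_rcons perm_cons perm_sym.
rewrite cut [RHS]cut; congr (_ + _); last first.
  rewrite !wavg_rcons; apply: eq_avg => x.
  (* With [x] fixed as last letter, the sign indicator is still permutation invariant, so it joins
     the weight in the induction hypothesis. *)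
  transitivity (wavg n (fun w => (neg (rcons w x) * F (rcons w x)) * phi (npos y w))).
    apply: eq_wavg => w _; rewrite -mulrA /neg npos_rcons leNgt.
    by case: (0 < _) => /=; rewrite ?mul0r // addn0.
  rewrite IH => [|u v uv]; last by rewrite /neg (src x u v) // (Frc x u v).
  apply: eq_wavg => w _; rewrite -mulrA /neg.
  case: (lerP (wsum y (rcons w x)) 0) => s0; last by rewrite !mul0r.
  by rewrite argmax_rcons // (le_trans s0 (wmax_ge0 _ _)).
rewrite [LHS]wavg_rcons; apply: eq_avg => x.
transitivity (wavg n (fun w => (pos (rcons w x) * F (rcons w x)) *
                               (phi \o succn) (npos y w))).
  apply: eq_wavg => w _; rewrite -mulrA /pos npos_rcons.
  by case: (0 < _) => /=; rewrite ?mul0r // addn1.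
rewrite IH => [|u v uv]; last by rewrite /pos (src x u v) // (Frc x u v).
apply: eq_wavg => w _; rewrite -mulrA /pos.
(* [npos] has dropped the last letter and [argmax] drops the first; [F] and the total do not see
   where [x] stands. *)
have px : perm_eq (rcons w x) (x :: w) by rewrite perm_rcons.
rewrite (Fp _ _ px) (wsum_perm _ _ px).
case: ltrP => s0; last by rewrite !mul0r.
by rewrite argmax_cons.
Qed.

Definition P_pos (T : finType) (y : T -> int) n : rat :=
  wavg n (fun w => (suffpos y w)%:R).

Definition P_nonpos (T : finType) (y : T -> int) n : rat :=
  wavg n (fun w => (wmax y w == 0)%:R).

Lemma wavg_argmax (T : finType) (y : T -> int) n r : (r <= n)%N ->
  wavg n (fun w => (argmax y w == r)%:R) = P_pos y r * P_nonpos y (n - r).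
Proof.
move=> rn; rewrite -{1}(subnKC rn) wavg_cat /P_pos mulrC -wavgZ.
apply: eq_wavg => u su; rewrite [RHS]mulrC -wavgZ; apply: eq_wavg => v _.
by rewrite -su argmax_cat -mulnb natrM.
Qed.

Lemma sum_P_pos_nonpos (T : finType) (y : T -> int) n : (0 < #|T|)%N ->
  \sum_(r < n.+1) P_pos y r * P_nonpos y (n - r) = 1.
Proof.
move=> T0; rewrite -[RHS](wavg_const n 1 T0).
transitivity (\sum_(r < n.+1) wavg n (fun w => (argmax y w == r)%:R)).
  by apply: eq_bigr => r _; rewrite wavg_argmax // -ltnS.
rewrite -wavg_sum //; apply: eq_wavg => w sw.
have lt_n : (argmax y w < n.+1)%N by rewrite ltnS -sw argmax_le.
rewrite (bigD1 (Ordinal lt_n)) //= eqxx big1 ?addr0 // => i.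
by rewrite -val_eqE /= eq_sym => /negbTE ->.
Qed.

Lemma wavg01 (T : finType) n (b : seq T -> bool) : (0 < #|T|)%N ->
  0 <= wavg n (fun w => (b w)%:R) <= 1.
Proof.
move=> T0; apply/andP; split.
  by rewrite -(wavg_const n 0 T0); apply: ler_wavg => w _; case: (b w).
by rewrite -[leRHS](wavg_const n 1 T0); apply: ler_wavg => w _; case: (b w).
Qed.

(* Under the reflection [y -> 2 - y] (the discrete substitute for a symmetric
   step), a suffix sum is nonpositive iff it was at least twice its length. *)
Fixpoint suffge2 (T : Type) (y : T -> int) (w : seq T) : bool :=
  if w is x :: w' then ((2 * size w)%:Z <= wsum y w) && suffge2 y w' else true.

Lemma suffge2_suffpos (T : Type) (y : T -> int) w : suffge2 y w -> suffpos y w.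
Proof. by elim: w => [|x w IH] //= /andP[s2 /IH ->]; rewrite andbT; lia. Qed.

Lemma wsum_reflect (T : Type) (y : T -> int) (h : T -> T) w :
  (forall x, y (h x) = 2 - y x) ->
  wsum y (map h (rev w)) = (2 * size w)%:Z - wsum y w.
Proof.
move=> yh; elim: w => [|x w IH]; first by rewrite /wsum !big_nil.
rewrite rev_cons map_rcons wsum_rcons IH yh wsum_cons /=; lia.
Qed.

(** The prefix sum of length j of the reversed, reflected word is 2j minus the sum of the suffix of
    length j. *)
Lemma wmax_reflect (T : Type) (y : T -> int) (h : T -> T) w :
  (forall x, y (h x) = 2 - y x) ->
  (wmax y (map h (rev w)) == 0) = suffge2 y w.
Proof.
move=> yh; elim: w => [|x w IH] //.
rewrite rev_cons map_rcons wmax_rcons -map_rcons -rev_cons wsum_reflect //.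
rewrite [RHS]/= -IH -/(size (x :: w)).
by have := wmax_ge0 y (map h (rev w)); move: (2 * _)%N (wsum _ (x :: w)); lia.
Qed.

Lemma P_nonpos_reflect (T : finType) (y : T -> int) (h : T -> T) n :
  injective h -> (forall x, y (h x) = 2 - y x) ->
  P_nonpos y n = wavg n (fun w => (suffge2 y w)%:R).
Proof.
move=> hI yh; rewrite /P_nonpos -(wavg_map n _ hI) -wavg_rev.
by apply: eq_wavg => w _; rewrite wmax_reflect.
Qed.

(** Once all letters but the first are fixed, the total hits [c] for only one value of the first
    step. *)
Lemma wavg_wsum_le (T : finType) (y : T -> int) d n c : (0 < #|T|)%N ->
  (forall c, avg (fun x => (y x == c)%:R) <= d) ->
  wavg n.+1 (fun w => (wsum y w == c)%:R) <= d.
Proof.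
move=> T0 yd; rewrite wavgS -(wavg_const n d T0); apply: ler_wavg => w _.
apply: le_trans (yd (c - wsum y w)); apply: ler_avg => x.
by rewrite wsum_cons [_ == _ - _]eq_sym subr_eq eq_sym.
Qed.

(** The indicators differ only if some suffix of length j has its sum strictly between 0 and 2j. A
    union bound costs at most 2jd for each j up to n, and 2n^2 d bounds the total. *)
Lemma wavg_suff_gap (T : finType) (y : T -> int) d n : (0 < #|T|)%N ->
  (forall c, avg (fun x => (y x == c)%:R) <= d) ->
  wavg n (fun w => (suffpos y w)%:R - (suffge2 y w)%:R) <= (2 * n ^ 2)%:R * d.
Proof.
move=> T0 yd.
have d0 : 0 <= d.
  by apply: le_trans (yd 0); rewrite -[leLHS](avg_const 0 T0); apply: ler_avg => x; case: eqP.
(* Below, [f] indicates a total in [0, 2(n+1)), which covers a new failure at full length; [g] of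
   the tail accounts for the shorter suffixes. *)
elim: n => [|n IH]; first by rewrite /= subrr mul0r.
pose f (w : seq T) : rat := \sum_(c < 2 * n.+1) (wsum y w == c)%:R.
pose g (w : seq T) : rat := (suffpos y w)%:R - (suffge2 y w)%:R.
apply: (@le_trans _ _ (wavg n.+1 (fun w => f w + g (behead w)))).
  apply: ler_wavg => -[|x w] //= [sw].
  rewrite /g /= sw.
  have f0 : 0 <= f (x :: w) by apply: sumr_ge0 => c _; case: eqP.
  have f1 : 0 < wsum y (x :: w) -> wsum y (x :: w) < (2 * n.+1)%:Z -> 1 <= f (x :: w).
    move=> s0 sn; have ln : (`|wsum y (x :: w)| < 2 * n.+1)%N by lia.
    rewrite /f (bigD1 (Ordinal ln)) //= gtz0_abs // eqxx lerDl.
    by apply: sumr_ge0 => c _; case: eqP.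
  have : (suffge2 y w)%:R <= (suffpos y w)%:R :> rat.
    by rewrite ler_nat; have := @suffge2_suffpos _ y w; case: suffge2 => // ->.
  case: (ltrP 0 (wsum y (x :: w))) => s0 /=;
    case: (lerP (2 * n.+1)%:Z (wsum y (x :: w))) => s2 /=; first by lra.
  - have := f1 s0 s2; case: (suffpos _ _); case: (suffge2 _ _) => /=; lra.
  - by lia.
  - by lra.
rewrite wavgD.
have -> : wavg n.+1 (fun w => g (behead w)) = wavg n g.
  by rewrite [LHS]/= avg_const.
apply: (@le_trans _ _ ((2 * n.+1)%:R * d + (2 * n ^ 2)%:R * d)).
  apply: lerD => //; rewrite /f wavg_sum //.
  have -> : (2 * n.+1)%:R * d = \sum_(c < 2 * n.+1) d.
    by rewrite sumr_const card_ord mulr_natl.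
  by apply: ler_sum => c _; exact: wavg_wsum_le.
rewrite -mulrDl ler_wpM2r // -natrD ler_nat; nia.
Qed.

(** * Limits as the alphabet grows *)

(* The functions are indexed by [M], with alphabet size [M.+1]. *)
Definition near (a b : nat -> rat) : Prop :=
  exists C, forall M, `|a M - b M| <= C / M.+1%:R.

Lemma near_trans a b c : near a b -> near b c -> near a c.
Proof.
move=> [C aC] [D bD]; exists (C + D) => M.
rewrite mulrDl (le_trans _ (lerD (aC M) (bD M))) //.
by rewrite (le_trans _ (ler_normD _ _)) // addrA subrK.
Qed.

Lemma eq_near a b : a =1 b -> near a b.
Proof. by move=> ab; exists 0 => M; rewrite ab subrr normr0 mul0r. Qed.

Lemma near_sym a b : near a b -> near b a.
Proof. by move=> [C aC]; exists C => M; rewrite distrC. Qed.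

Lemma nearD a b a' b' : near a a' -> near b b' ->
  near (fun M => a M + b M) (fun M => a' M + b' M).
Proof.
move=> [C aC] [D bD]; exists (C + D) => M.
rewrite mulrDl (le_trans _ (lerD (aC M) (bD M))) //.
by rewrite (le_trans _ (ler_normD _ _)) // opprD addrACA.
Qed.

Lemma nearZ c a b : near a b -> near (fun M => c * a M) (fun M => c * b M).
Proof.
move=> [C aC]; exists (`|c| * C) => M.
by rewrite -mulrBr normrM -mulrA ler_wpM2l.
Qed.

Lemma nearM a b x z : (forall M, `|a M| <= 1) ->
  near a (fun=> x) -> near b (fun=> z) -> near (fun M => a M * b M) (fun=> x * z).
Proof.
move=> a1 [C aC] [D bD]; exists (D + `|z| * C) => M.
have -> : a M * b M - x * z = a M * (b M - z) + z * (a M - x) by ring.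
rewrite (le_trans (ler_normD _ _)) // !normrM mulrDl -mulrA lerD //.
  by rewrite -[leRHS]mul1r ler_pM.
by rewrite ler_wpM2l.
Qed.

Lemma near_sum n (a b : 'I_n -> nat -> rat) : (forall i, near (a i) (b i)) ->
  near (fun M => \sum_i a i M) (fun M => \sum_i b i M).
Proof.
elim: n a b => [|n IH] a b ab; first by apply: eq_near => M; rewrite !big_ord0.
apply: near_trans (near_trans (nearD (ab ord0) (IH _ _ (fun i => ab (lift ord0 i)))) _).
  by apply: eq_near => M; rewrite big_ord_recl.
by apply: eq_near => M; rewrite big_ord_recl.
Qed.

(** This Archimedean step extracts exact equalities from the O(1/K) estimates. *)
Lemma near_const x z : near (fun=> x) (fun=> z) -> x = z.
Proof.
move=> [C xz]; apply/eqP; rewrite -subr_eq0 -normr_le0 leNgt; apply/negP => d0.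
set d := `|_| in d0 xz.
have := archi_boundP (divr_ge0 (normr_ge0 C) (ltW d0)).
set m := Num.bound _ => Cm; have := xz m; apply/negP; rewrite -ltNge -/d.
rewrite ltr_pdivrMr ?ltr0Sn // mulrC -ltr_pdivrMr //.
have := ler_norm C; rewrite -(ler_pM2r (_ : 0 < d^-1)) ?invr_gt0 // => h.
by rewrite (le_lt_trans h) // (lt_trans Cm) // ltr_nat.
Qed.

(** * Central binomial weights, the coefficients of (1 - x)^(-1/2) *)

Definition arcs (r : nat) : rat := 'C(2 * r, r)%:R / 2 ^+ (2 * r).

Lemma central_binS r : (r.+1 * 'C(2 * r.+1, r.+1) = 2 * (2 * r + 1) * 'C(2 * r, r))%N.
Proof.
have := mul_bin_diag (2 * r).+2 r; have := mul_bin_down (2 * r).+1 r.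
by rewrite mulnS add2n /= (_ : ((2 * r).+1 - r = r.+1)%N); lia.
Qed.

Lemma arcs0 : arcs 0 = 1.
Proof. by []. Qed.

Lemma arcsS r : r.+1%:R * arcs r.+1 = (r%:R + 2^-1) * arcs r.
Proof.
have := congr1 (fun m => m%:R : rat) (central_binS r).
rewrite /= !natrM natrD natrM => e.
rewrite /arcs [LHS]mulrA e mulnS exprD.
by field; rewrite expf_neq0.
Qed.

(** Squaring (1 - x)^(-1/2) gives 1/(1 - x). In elementary terms, the symmetry between r and n - r
    gives r the mean n/2 under these weights, and [arcsS] then turns the sum for n into the sum for
    n + 1. *)
Lemma arcs_conv n : \sum_(r < n.+1) arcs r * arcs (n - r) = 1.
Proof.
have sym m : \sum_(r < m.+1) r%:R * (arcs r * arcs (m - r)) =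
             m%:R / 2 * \sum_(r < m.+1) arcs r * arcs (m - r).
  set S := LHS; suff : S + S = m%:R * \sum_(r < m.+1) arcs r * arcs (m - r).
    by move=> SS; rewrite mulrAC -SS; field.
  rewrite {2}/S (reindex_inj rev_ord_inj) -big_split mulr_sumr /=.
  apply: eq_bigr => r _; rewrite subSS subKn ?leq_ord // natrB ?leq_ord //; ring.
elim: n => [|n IH]; first by rewrite big_ord1 /arcs.
have := sym n.+1; rewrite big_ord_recl mul0r add0r.
under eq_bigr => r _ do rewrite /= /bump add1n subSS mulrA arcsS -mulrA mulrDl.
rewrite big_split -mulr_sumr sym IH /= mulr1 => e.
have n0 : n.+1%:R / 2 != 0 :> rat by rewrite mulf_neq0 // pnatr_eq0.
by apply: (mulfI n0); rewrite -e mulr1 -natr1; field.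
Qed.

(** * Limit law for the walk of paired letters *)

Definition ystep (K : nat) (p : 'I_K * 'I_K) : int := K%:Z - p.1%:Z - p.2%:Z.

Definition srev (K : nat) (p : 'I_K * 'I_K) : 'I_K * 'I_K := (rev_ord p.1, rev_ord p.2).

(** Letters run from 0 to K - 1, so a step is symmetric about 1 instead of 0. *)
Lemma ystep_srev (K : nat) (p : 'I_K * 'I_K) : ystep (srev p) = 2 - ystep p.
Proof.
by case: p => a b; rewrite /ystep /=; have := ltn_ord a; have := ltn_ord b; lia.
Qed.

Lemma srev_inj (K : nat) : injective (@srev K).
Proof.
move=> [a b] [c d] e; congr (_, _); apply: rev_ord_inj.
  exact: (congr1 fst e).
exact: (congr1 snd e).
Qed.

Lemma avg_pred1_le (T : finType) (b : pred T) :
  {in b &, forall x z, x = z} -> avg (fun x => (b x)%:R) <= #|T|%:R^-1.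
Proof.
move=> b1; rewrite /avg ler_piMl ?invr_ge0 // -natr_sum (_ : 1 = 1%:R) // ler_nat.
have [x bx|b0] := pickP b; last by rewrite big1 // => z _; rewrite b0.
rewrite (bigD1 x) //= big1 ?addn0 ?leq_b1 // => z /negP zx.
by case bz: (b z) => //; case: zx; apply/eqP/b1.
Qed.

Lemma ystep_conc (M : nat) c :
  avg (fun p : 'I_M.+1 * 'I_M.+1 => (ystep p == c)%:R) <= M.+1%:R^-1.
Proof.
rewrite avg_pair -[leRHS](@avg_const 'I_M.+1) ?card_ord //.
apply: ler_avg => a; rewrite -[in leRHS](card_ord M.+1).
apply: (@avg_pred1_le _ (fun b => ystep (a, b) == c)) => b b'.
rewrite !unfold_in /ystep /= => /eqP e1 /eqP e2; apply/val_inj => /=; lia.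
Qed.

(** By reflection [P_nonpos] is the probability of [suffge2], and [wavg_suff_gap] applies with d =
    1/(M+1), since one letter of a pair and the value of the step determine the other letter. *)
Lemma P_gap r : near (fun M => P_nonpos (@ystep M.+1) r) (fun M => P_pos (@ystep M.+1) r).
Proof.
exists (2 * r ^ 2)%:R => M; rewrite distrC.
rewrite (P_nonpos_reflect _ (@srev_inj _) (@ystep_srev _)) /P_pos.
rewrite -mulN1r -wavgZ -wavgD.
under eq_wavg do rewrite mulN1r.
rewrite ger0_norm.
  by apply: wavg_suff_gap; [rewrite card_prod card_ord | exact: ystep_conc].
rewrite -(wavg_const r 0 (_ : (0 < #|{: 'I_M.+1 * 'I_M.+1}|)%N)) ?card_prod ?card_ord //.
apply: ler_wavg => w _; rewrite subr_ge0 ler_nat.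
by have := @suffge2_suffpos _ (@ystep M.+1) w; case: suffge2 => // ->.
Qed.

Lemma P_pos_norm r M : `|P_pos (@ystep M.+1) r| <= 1.
Proof.
have /andP[h0 h1] := @wavg01 _ r (suffpos (@ystep M.+1))
   (ltac:(by rewrite card_prod card_ord)).
by rewrite ger0_norm.
Qed.

(** In [sum_P_pos_nonpos] for r + 1 steps the two extreme terms agree up to O(1/K) by [P_gap], and
    the middle sum [S] converges by induction. [arcs_conv] is the same relation for the limits, so
    the values agree. *)
Lemma P_pos_near r : near (fun M => P_pos (@ystep M.+1) r) (fun=> arcs r).
Proof.
elim/ltn_ind: r => -[|r] IH; first exact: eq_near.
pose S M := \sum_(i < r) P_pos (@ystep M.+1) i.+1 * P_nonpos (@ystep M.+1) (r - i).
pose Q M := P_pos (@ystep M.+1) r.+1; pose Q' M := P_nonpos (@ystep M.+1) r.+1.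
have totE M : Q' M + (S M + Q M) = 1.
  rewrite -(@sum_P_pos_nonpos _ (@ystep M.+1) r.+1) ?card_prod ?card_ord //.
  rewrite big_ord_recl subn0 /P_pos /= mul1r big_ord_recr /= subnn; congr (_ + (_ + _)).
  by rewrite /P_nonpos /= mulr1.
pose s := \sum_(i < r) arcs i.+1 * arcs (r - i).
have totq : arcs r.+1 + (s + arcs r.+1) = 1.
  rewrite -(arcs_conv r.+1) big_ord_recl big_ord_recr /= subn0 subnn arcs0.
  by rewrite mul1r mulr1.
have Ss : near S (fun=> s).
  apply: near_sum => i; apply: nearM; first by move=> M; exact: P_pos_norm.
    by apply: IH; rewrite ltnS.
  by apply: near_trans (P_gap _) _; apply: IH; rewrite ltnS leq_subr.
have QQ : near Q (fun M => 1 - S M - Q M).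
  apply: near_trans (near_sym (P_gap _)) _; apply: eq_near => M.
  by rewrite -(totE M) -/(Q' M); ring.
(* Adding [Q] to both sides of [QQ] cancels the unknown on the right: 2Q is near 1 - s. *)
have h : near (fun M => 2^-1 * (Q M + Q M)) (fun=> 2^-1 * (1 - s)).
  apply: nearZ; apply: near_trans (nearD QQ (eq_near (frefl Q))) _.
  apply: near_trans (near_trans _ (nearD (eq_near (frefl (fun=> 1))) (nearZ (-1) Ss))) _.
    by apply: eq_near => M; rewrite mulN1r subrK.
  by apply: eq_near => M; rewrite mulN1r.
apply: near_trans (near_trans h _); apply: eq_near => M; first by rewrite /Q; field.
by move: totq; lra.
Qed.

Lemma npos_near n k : (k <= n)%N ->
  near (fun M => wavg n (fun w => (npos (@ystep M.+1) w == k)%:R))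
       (fun=> arcs k * arcs (n - k)).
Proof.
move=> kn.
apply: near_trans (nearM (P_pos_norm k) (P_pos_near k)
  (near_trans (P_gap (n - k)) (P_pos_near (n - k)))).
apply: eq_near => M; rewrite -wavg_argmax //.
have := @sparre_andersen _ (@ystep M.+1) n (fun=> 1) (fun m => (m == k)%:R) (fun _ _ _ => erefl).
by under eq_wavg do rewrite mul1r; move=> ->; apply: eq_wavg => w _; rewrite mul1r.
Qed.

(** * From permutations to words *)

Definition des (a : nat -> nat) (i : nat) : nat :=
  (\sum_(j < i) (a j.+1 < a j))%N.

(** After j steps with d descents the walk is at j - 2d, so 2d <= j says that it is nonnegative. *)
Definition count_above (a : nat -> nat) (m : nat) : nat :=
  (\sum_(j < m) ((2 * des a j <= j) && (2 * des a j.+1 <= j.+1)))%N.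

Lemma desS a i : des a i.+1 = (des a i + (a i.+1 < a i))%N.
Proof. by rewrite /des big_ord_recr. Qed.

(** At the odd time 2i+1 the walk is not 0, so at times 2i and 2i+2 it is weakly on the same side,
    and the two edges meeting there count together. Being positive there means at most i
    descents. *)
Lemma count_above_even a n :
  count_above a (2 * n) = (2 * \sum_(i < n) (des a (2 * i).+1 <= i))%N.
Proof.
elim: n => [|n IH]; first by rewrite /count_above !big_ord0.
rewrite mulnS add2n /count_above !big_ord_recr -/(count_above _ _) IH /= mulnDr -addnA.
congr (_ + _)%N; rewrite !desS.
by case: (_ < _)%N; case: (_ < _)%N; lia.
Qed.

Lemma eq_count_above a b m :
  (forall j, (j < m)%N -> (a j.+1 < a j)%N = (b j.+1 < b j)%N) ->
  count_above a m = count_above b m.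
Proof.
move=> ab; have dab i : (i <= m)%N -> des a i = des b i.
  by move=> im; apply: eq_bigr => j _; rewrite ab // (leq_trans (ltn_ord j)).
by apply: eq_bigr => j _; rewrite !dab // ltnW.
Qed.

Lemma numNE m (s : 'S_m.+1) : numN s = count_above (fun j => s (inord j)) m.
Proof.
have wE i : (i <= m)%N -> walkS s i = i%:Z - 2 * (des (fun j => s (inord j)) i)%:Z.
  elim: i => [|i IH] im; first by rewrite /walkS big_nil /des big_ord0.
  rewrite /walkS big_nat_recr //= -/(walkS s i) IH ?(ltnW im) // desS.
  rewrite /stepX /oneline /= ltnS ltnNge leq_eqVlt.
  (* Adjacent values differ, so a step that is not an ascent is a strict descent. *)
  have -> : (val (s (inord i.+1)) == val (s (inord i))) = false.
    rewrite val_eqE (inj_eq perm_inj); apply/negP => /eqP /(congr1 val) /=.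
    by rewrite !inordK; lia.
  by case: (_ < _)%N => /=; lia.
rewrite /numN big_add1 /= big_mkord; apply: eq_bigr => j _.
by rewrite !wE ?(ltnW (ltn_ord j)) //; congr (nat_of_bool (_ && _)); lia.
Qed.

(** * Descents of running sums modulo the alphabet size *)

Definition word (K : nat) (w : seq 'I_K) (j : nat) : nat := nth 0%N [seq val x | x <- w] j.

Lemma val_foldl_addr K (p : 'I_K.+1) w :
  val (foldl +%R p w) = ((p + \sum_(x <- w) val x) %% K.+1)%N.
Proof.
elim: w p => [|x w IH] p /=; first by rewrite big_nil addn0 modn_small.
by rewrite IH big_cons /= modnDml addnA.
Qed.

(** A running residue descends exactly when adding the next letter wraps past K+1, which is when the
    integer quotient grows by one. The first letter is below K+1, so the quotient starts at 0. *)
Lemma des_scanl K (w : seq 'I_K.+1) m : (m < size w)%N ->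
  des (word (scanl +%R 0 w)) m = ((\sum_(x <- take m.+1 w) val x) %/ K.+1)%N.
Proof.
have wordE j : (j < size w)%N -> word (scanl +%R 0 w) j =
    ((\sum_(x <- take j.+1 w) val x) %% K.+1)%N.
  move=> jw; rewrite /word (nth_map 0) ?size_scanl // nth_scanl //.
  by rewrite val_foldl_addr add0n.
have sumS j : (j < size w)%N -> (\sum_(x <- take j.+1 w) val x =
    \sum_(x <- take j w) val x + val (nth 0%R w j))%N.
  by move=> jw; rewrite (take_nth 0) // -cats1 big_cat big_seq1.
elim: m => [|m IH] mw.
  by rewrite /des big_ord0 sumS // take0 big_nil add0n divn_small //; exact: ltn_ord.
rewrite desS IH ?(ltnW mw) // !wordE ?(ltnW mw) // [in RHS]sumS //.
rewrite (sumS m.+1) //; move: (\sum_(x <- _) _)%N (nth _ _ _) => Q v.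
have := divn_eq Q K.+1; have := ltn_pmod Q (ltn0Sn K); have := ltn_ord v.
set q := (Q %/ _)%N; set r := (Q %% _)%N => vK rK ->.
rewrite -addnA modnMDl divnMDl //; congr (_ + _)%N.
have [rv|rv] := ltnP (r + v) K.+1.
  by rewrite modn_small // divn_small //; lia.
rewrite -(subnK rv) modnDr divnDr // divnn /= modn_small ?divn_small; lia.
Qed.

Lemma wsum_ystep K (w : seq ('I_K * 'I_K)) :
  wsum (@ystep K) w = (K * size w)%:Z - (\sum_(x <- flat w) val x)%N%:Z.
Proof.
elim: w => [|[a b] w IH]; first by rewrite /wsum !big_nil muln0.
by rewrite wsum_cons IH /flat /= !big_cons /ystep /= mulnS; lia.
Qed.

Lemma take_flat (T : Type) (w : seq (T * T)) i : take (2 * i) (flat w) = flat (take i w).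
Proof.
elim: w i => [|x w IH] [|i] //.
by have := IH i; rewrite /flat mulnS /= => ->.
Qed.

Lemma size_flat (T : Type) (w : seq (T * T)) : size (flat w) = (2 * size w)%N.
Proof. by elim: w => [|x w IH] //=; rewrite mulnS -IH. Qed.

(** The edges around time 2i+1 count iff the first 2(i+1) letters sum to less than (i+1)(K+1), that
    is, iff the first i+1 pairs have positive [wsum]. These odd times read only letters before
    [x]. *)
Lemma count_above_npos K (w : seq ('I_K.+1 * 'I_K.+1)) x :
  count_above (word (scanl +%R 0 (rcons (flat w) x))) (2 * size w) =
  (2 * npos (@ystep K.+1) w)%N.
Proof.
rewrite count_above_even; congr (2 * _)%N; apply: eq_bigr => i _; congr nat_of_bool.
have iw := ltn_ord i.
rewrite des_scanl ?size_rcons ?size_flat; last by lia.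
rewrite -cats1 takel_cat ?size_flat; last by lia.
have -> : (2 * i).+2 = (2 * i.+1)%N by lia.
rewrite take_flat wsum_ystep size_takel // -ltnS ltn_divLR // [(i.+1 * _)%N]mulnC.
by rewrite subr_gt0 ltz_nat.
Qed.

Lemma wavg_count_above K n k :
  wavg (2 * n).+1 (fun w => (count_above (word (w : seq 'I_K.+1)) (2 * n) == (2 * k)%N)%:R) =
  wavg n (fun w => (npos (@ystep K.+1) w == k)%:R).
Proof.
rewrite -(wavg_scanl _ 0) wavg_rcons.
rewrite -[RHS](@avg_const 'I_K.+1) ?card_ord //; apply: eq_avg => x.
rewrite wavg_flat; apply: eq_wavg => w sw.
by rewrite -sw count_above_npos eqn_pmul2l.
Qed.

(** * Relative order of words with distinct letters *)

Lemma order_perm L (v : 'I_L -> nat) : injective v ->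
  exists t : 'S_L, forall i j, (t i < t j)%N = (v i < v j)%N.
Proof.
(* The permutation sends i to the rank of [v i], the number of indices with a smaller value. *)
move=> vI; pose A i := [set j | (v j < v i)%N].
have Alt i : (#|A i| < L)%N.
  rewrite -[X in (_ < X)%N](card_ord L) -cardsT proper_card // properT.
  by apply/negP => /eqP /setP /(_ i); rewrite !inE ltnn.
have Amon i j : (v i < v j)%N -> (#|A i| < #|A j|)%N.
  move=> vij; apply: proper_card; apply/properP; split.
    by apply/subsetP => l; rewrite !inE => /ltn_trans; apply.
  by exists i; rewrite !inE ?ltnn.
have Aiff i j : (#|A i| < #|A j|)%N = (v i < v j)%N.
  case: (ltngtP (v i) (v j)) => [/Amon -> //|/Amon h|/vI ->]; last by rewrite ltnn.
  by rewrite ltnNge ltnW.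
have tI : injective (fun i => Ordinal (Alt i)).
  move=> i j /(congr1 val) /= e; apply: vI.
  by case: (ltngtP (v i) (v j)) => // /Amon; rewrite e ltnn.
by exists (perm tI) => i j; rewrite !permE /=.
Qed.

Lemma unif_perm_probE m (E : pred 'S_m) : unif_perm_prob E = avg (fun s => (E s)%:R).
Proof.
rewrite /unif_perm_prob /avg card_Sn big_mkcond mulr_suml.
by apply: eq_bigr => s _; case: (E s); rewrite ?mul1r ?mul0r.
Qed.

Definition permute (L : nat) (T : Type) (t : L.-tuple T) (s : 'S_L) : L.-tuple T :=
  [tuple tnth t (s i) | i < L].

Lemma permute_inj (L : nat) (T : finType) (s : 'S_L) :
  injective (fun t : L.-tuple T => permute t s).
Proof.
move=> t u /(congr1 (@tnth _ _)) e; apply: eq_from_tnth => i.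
by have := congr1 (fun f => f (s^-1 i)%g) e; rewrite !tnth_mktuple permKV.
Qed.

Lemma word_tnth K L (t : L.-tuple 'I_K) (i : 'I_L) : word t i = tnth t i.
Proof. by rewrite /word (nth_map (tnth t i)) ?size_tuple // -tnth_nth. Qed.

(** If [tau] ranks the distinct letters of [t], the word permuted by [s] has the descents of s *
    tau, which is uniform when [s] is. *)
Lemma avg_permute K m (t : m.+1.-tuple 'I_K) c : uniq t ->
  avg (fun s : 'S_m.+1 => (count_above (word (permute t s)) m == c)%:R) =
  unif_perm_prob (fun s : 'S_m.+1 => numN s == c).
Proof.
move=> /tuple_uniqP tI.
have [tau tauE] := @order_perm m.+1 (fun i => val (tnth t i)) (inj_comp val_inj tI).
rewrite unif_perm_probE -[RHS](avg_reindex _ (mulIg tau)); apply: eq_avg => s.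
rewrite numNE; congr ((_ == _)%:R); apply: eq_count_above => j jm.
have wordE i : (i <= m)%N -> word (permute t s) i = tnth t (s (inord i)).
  move=> im; have {1}-> : i = (inord i : 'I_m.+1) by rewrite inordK.
  by rewrite word_tnth tnth_mktuple.
by rewrite !wordE ?(ltnW jm) // !permM tauE.
Qed.

(** Union bound: a new letter repeats one of n others with probability at most n/(K+1), and n + n^2
    <= (n+1)^2. *)
Lemma wavg_not_uniq K n :
  wavg n (fun w : seq 'I_K.+1 => (~~ uniq w)%:R) <= (n ^ 2)%:R / K.+1%:R.
Proof.
elim: n => [|n IH]; first by rewrite /= mul0r.
rewrite wavgS; pose c : rat := n%:R / K.+1%:R.
apply: (@le_trans _ _ (wavg n (fun w : seq 'I_K.+1 => c + (~~ uniq w)%:R))).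
  apply: ler_wavg => w sw.
  apply: (@le_trans _ _ (avg (fun x => (x \in w)%:R + (~~ uniq w)%:R))).
    by apply: ler_avg => x /=; case: (x \in w); case: uniq.
  rewrite avgD avg_const ?card_ord // lerD2r /avg /c card_ord ler_wpM2r ?invr_ge0 ?ler0n //.
  rewrite -natr_sum ler_nat -big_mkcond sum1_card.
  by rewrite (leq_trans (card_size _)) ?sw.
rewrite wavgD wavg_const ?card_ord // (le_trans (lerD (lexx _) IH)) //.
by rewrite -mulrDl ler_wpM2r ?invr_ge0 ?ler0n // -natrD ler_nat; nia.
Qed.

(** Shuffling the positions of a uniform word by an independent uniform permutation preserves its
    law. For a word with distinct letters the shuffle alone yields the permutation probability
    exactly, so the error is at most the chance of a repetition. *)
Lemma unif_perm_prob_near m c :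
  near (fun K => wavg m.+1 (fun w => (count_above (word (w : seq 'I_K.+1)) m == c)%:R))
       (fun=> unif_perm_prob (fun s : 'S_m.+1 => numN s == c)).
Proof.
set p := unif_perm_prob _; exists (m.+1 ^ 2)%:R => K.
have avgS01 (b : 'S_m.+1 -> bool) : 0 <= avg (fun s => (b s)%:R) <= 1.
  have S0 : (0 < #|'S_m.+1|)%N by rewrite card_Sn fact_gt0.
  apply/andP; split.
    by rewrite -[leLHS](avg_const _ S0); apply: ler_avg => s; case: (b s).
  by rewrite -[leRHS](avg_const _ S0); apply: ler_avg => s; case: (b s).
set f := fun w : seq 'I_K.+1 => _.
apply: le_trans (wavg_not_uniq K m.+1).
have -> : wavg m.+1 f = avg (fun t : m.+1.-tuple 'I_K.+1 =>
    avg (fun s : 'S_m.+1 => f (permute t s))).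
  rewrite avg_exchange wavg_tuple.
  rewrite -[LHS](@avg_const 'S_m.+1) ?card_Sn ?fact_gt0 //; apply: eq_avg => s.
  by rewrite -(avg_reindex (fun t : m.+1.-tuple 'I_K.+1 => f t) (@permute_inj _ _ s)).
have T0 : (0 < #|{: m.+1.-tuple 'I_K.+1}|)%N by rewrite card_tuple card_ord expn_gt0.
rewrite wavg_tuple -[p](avg_const _ T0) -mulN1r -avgZ -avgD.
apply: le_trans (avg_norm _) _; apply: ler_avg => t.
case ut: (uniq t) => /=; first by rewrite /f avg_permute // mulN1r subrr normr0.
rewrite mulN1r /p unif_perm_probE.
have /andP[] := avgS01 (fun s => numN s == c).
have /andP[] := avgS01 (fun s => count_above (word (permute t s)) m == c).
by rewrite /f ler_norml; lra.
Qed.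

Theorem theorem0p1 (n : nat) (n_ge1 : (1 <= n)%N) (k : nat) (k_le_n : (k <= n)%N) :
  unif_perm_prob (fun s : 'S_(2 * n).+1 => numN s == (2 * k)%N) =
  (2 ^+ (2 * n))^-1 * ('C(2 * k, k))%:R * ('C(2 * n - 2 * k, n - k))%:R.
Proof.
transitivity (arcs k * arcs (n - k)).
  apply/near_const/(near_trans (near_sym (unif_perm_prob_near _ _))).
  apply: near_trans (npos_near k_le_n).
  by apply: eq_near => K; rewrite wavg_count_above.
rewrite /arcs -mulnBr; have -> : (2 * n = 2 * k + 2 * (n - k))%N by lia.
by rewrite exprD; field; rewrite !expf_neq0.
Qed.
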